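(* Among all trees with $n$ vertices, the star $S_n=K_{1,n-1}$ is the unique tree with maximum Randić incidence energy; that is, $I_RE(T)\leq I_RE(S_n)$ for every tree $T$ on $n$ vertices, with equality only if $T\cong S_n$.
   Context: All graphs are simple and finite. For a graph $G$ with vertex set $V(G)=\{v_1,\dots,v_n\}$, edge set $E(G)=\{e_1,\dots,e_m\}$ and degrees $d_i=\deg(v_i)$, the Randić incidence matrix $I_R(G)$ is the $n\times m$ matrix whose $(i,j)$-entry is $d_i^{-1/2}$ if $v_i$ is incident to $e_j$ and $0$ otherwise. Its singular values $\sigma_1(G),\dots,\sigma_n(G)$ are the square roots of the eigenvalues of the $n\times n$ matrix $I_R(G)I_R(G)^T$, and the Randić incidence energy is $I_RE(G)=\sum_{i=1}^n\sigma_i(G)$. *)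

(* Defs.v *)
From HB Require Import structures.
From mathcomp Require Import all_boot all_order all_algebra.
From mathcomp Require Import polyrcf.

Set Implicit Arguments.
Unset Strict Implicit.
Unset Printing Implicit Defensive.

Import Order.TTheory GRing.Theory Num.Theory.
Local Open Scope ring_scope.

Record sgraph := SGraph {
  vertex :> finType;
  adj : rel vertex;
  adj_sym : symmetric adj;
  adj_irrefl : irreflexive adj }.

Definition edges (G : sgraph) : {set {set G}} :=
  [set E : {set G} | [exists u : G, exists v : G, adj u v && (E == [set u; v])]].

Definition degree (G : sgraph) (v : G) : nat := #|[set u : G | adj v u]|.

Definition connected (G : sgraph) : Prop :=
  (0 < #|G|)%N /\ forall u v : G, connect (@adj G) u v.

Definition acyclic (G : sgraph) : Prop :=
  forall c : seq G, (2 < size c)%N -> ~ ucycle (@adj G) c.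

Definition tree (G : sgraph) : Prop := connected G /\ acyclic G.

Definition isomorphic (G H : sgraph) : Prop :=
  exists2 f : G -> H, bijective f & {mono f : u v / adj u v}.

Definition biclique_adj (p q : nat) : rel ('I_p + 'I_q)%type :=
  fun u v => match u, v with
             | inl _, inr _ | inr _, inl _ => true
             | _, _ => false
             end.

Lemma biclique_sym p q : symmetric (@biclique_adj p q).
Proof. by case=> ? []. Qed.

Lemma biclique_irrefl p q : irreflexive (@biclique_adj p q).
Proof. by case. Qed.

Definition biclique (p q : nat) : sgraph :=
  SGraph (@biclique_sym p q) (@biclique_irrefl p q).

(* This is a graph on n vertices for n > 0 only. *)
Definition star (n : nat) : sgraph := biclique 1 n.-1.

(* The roots in R of the characteristic polynomial, each repeated according to
   its multiplicity.  When A is symmetric the polynomial splits over R, so that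
   the list has length n. *)
Definition eigenvalues (R : rcfType) (n : nat) (A : 'M[R]_n) : seq R :=
  flatten [seq nseq (mup x (char_poly A)) x | x <- rootsR (char_poly A)].

(* The first dimension of M fixes how many there are: an m x n matrix has m
   singular values, some of them being 0 when n < m. *)
Definition singular_values (R : rcfType) (m n : nat) (M : 'M[R]_(m, n)) :
    seq R :=
  [seq Num.sqrt x | x <- eigenvalues (M *m M^T)].

Definition randic_incidence (R : rcfType) (G : sgraph) :
    'M[R]_(#|G|, #|edges G|) :=
  \matrix_(i < #|G|, j < #|edges G|)
    if enum_val i \in enum_val j then (Num.sqrt (degree (enum_val i))%:R)^-1
    else 0.

Definition randic_incidence_energy (R : rcfType) (G : sgraph) : R :=
  \sum_(s <- singular_values (randic_incidence R G)) s.

(* Main.v *)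
Require Import Defs.
From mathcomp Require Import all_boot all_order all_algebra.
From mathcomp Require Import polyrcf.
From mathcomp Require Import perm complex ring lra.

(** Without isolated vertices, [I_R I_R^T = 1 + N] with [N] the normalized
    adjacency matrix [D^(-1/2) A D^(-1/2)].  For a tree, [D^(1/2) 1] and its
    signed version along a proper 2-colouring show that 1 and -1 are
    eigenvalues of [N].  The other n - 2 eigenvalues have sum 0 because
    [tr N = 0], and [sqrt (1 + x) <= 1 + x / 2] with equality only at 0, so the
    energy is at most [sqrt 2 + (n - 2)], with equality iff they all vanish.
    Then [N ^ 3 = N], so the end points of every walk of length 3 are adjacent;
    since a tree has no 4-cycle, it has no path with 3 edges and is a star.
    Conversely the star satisfies [tr N^2 = 2], which makes the other
    eigenvalues vanish. *)

Set Implicit Arguments.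
Unset Strict Implicit.
Unset Printing Implicit Defensive.

Import Order.TTheory GRing.Theory Num.Theory.
Local Open Scope ring_scope.

(** * Spectra of real symmetric matrices *)

(** A real symmetric matrix is hermitian over [R[i]], so the spectral theorem applies there and the
    eigenvalues are real. [P] may stay complex: what is derived from it descends to [R] by
    injectivity. *)
Lemma symmetric_diagonalization (R : rcfType) n (A : 'M[R]_n) : A^T = A ->
  exists d : 'rV[R]_n, exists2 P : 'M[R[i]]_n, P \in unitmx &
    map_mx (real_complex R) A =
      invmx P *m diag_mx (map_mx (real_complex R) d) *m P.
Proof.
move=> A_sym; pose B := map_mx (real_complex R) A.
have B_real : B \is a mxOver Num.real.
  by apply/mxOverP => i j; rewrite mxE; apply/complex_realP; exists (A i j).
have B_herm : B \is hermitianmx _ false Num.conj.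
  apply: realsym_hermsym => //.
  by apply/is_hermitianmxP; rewrite expr0 scale1r map_mx_id // map_trmx A_sym.
have /mxOverP D_real := hermitian_spectral_diag_real B_herm.
exists (map_mx (@complex.Re R) (spectral_diag B)), (spectralmx B).
  exact: spectral_unit.
have -> : map_mx (real_complex R) (map_mx (@complex.Re R) (spectral_diag B)) =
          spectral_diag B.
  by apply/matrixP => i j; rewrite 2!mxE RRe_real.
exact/orthomx_spectralP/hermitian_normalmx.
Qed.

Lemma char_poly_conj (F : fieldType) n (P A : 'M[F]_n) : P \in unitmx ->
  char_poly (invmx P *m A *m P) = char_poly A.
Proof.
move=> P_unit; pose f := @polyC F.
have P'_unit : map_mx f P \in unitmx by rewrite map_unitmx.
have XE : invmx (map_mx f P) *m 'X%:M *m map_mx f P = 'X%:M.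
  by rewrite -mulmxA -scalar_mxC mulmxA mulVmx // mul1mx.
have conjE : char_poly_mx (invmx P *m A *m P) =
    invmx (map_mx f P) *m char_poly_mx A *m map_mx f P.
  by rewrite /char_poly_mx 2!map_mxM map_invmx mulmxBr mulmxBl XE.
by rewrite /char_poly conjE 2!det_mulmx mulrAC -det_mulmx mulVmx // det1 mul1r.
Qed.

Section SymmetricSpectrum.
Variables (R : rcfType) (n : nat) (A : 'M[R]_n) (d : 'rV[R]_n) (P : 'M[R[i]]_n).
Local Notation toC := (map_mx (real_complex R)).
Hypotheses (P_unit : P \in unitmx).
Hypothesis A_diag : toC A = invmx P *m diag_mx (toC d) *m P.

Lemma char_poly_add1_diagonalized :
  char_poly (1%:M + A) = \prod_i ('X - (1 + d 0 i)%:P).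
Proof.
apply: (map_poly_inj (real_complex R)).
rewrite map_char_poly map_mxD map_mx1 A_diag.
have -> : 1%:M = invmx P *m 1%:M *m P by rewrite mulmx1 mulVmx.
rewrite -mulmxDl -mulmxDr char_poly_conj //.
have -> : 1%:M + diag_mx (toC d) = diag_mx (\row_i (1 + d 0 i)%:C)%C.
  apply/matrixP => i j; rewrite !mxE.
  by case: eqP => _; rewrite ?mulr1n ?mulr0n ?addr0 // rmorphD.
rewrite char_poly_trig ?diag_mx_is_trig // rmorph_prod; apply: eq_bigr => i _.
by rewrite !mxE eqxx mulr1n /= map_polyXsubC.
Qed.

Lemma char_poly_diagonalized : char_poly A = \prod_i ('X - (d 0 i)%:P).
Proof.
apply: (map_poly_inj (real_complex R)).
rewrite map_char_poly A_diag char_poly_conj //.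
rewrite char_poly_trig ?diag_mx_is_trig // rmorph_prod; apply: eq_bigr => i _.
by rewrite !mxE eqxx mulr1n /= map_polyXsubC.
Qed.

Lemma mxtrace_diagonalized : \tr A = \sum_i d 0 i.
Proof.
apply: (@complexI R); rewrite -trace_map_mx A_diag -mulmxA mxtrace_mulC.
rewrite -mulmxA mulmxV // mulmx1 mxtrace_diag rmorph_sum.
by apply: eq_bigr => i _; rewrite mxE.
Qed.

(** This has the shape of [A_diag], so [mxtrace_diagonalized] applies to [A *m A] as well. *)
Lemma sqr_diagonalized :
  toC (A *m A) = invmx P *m diag_mx (toC (\row_i (d 0 i ^+ 2))) *m P.
Proof.
rewrite map_mxM A_diag -!mulmxA (mulmxA P) mulmxV // mul1mx.
rewrite (mulmxA (diag_mx _)).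
rewrite mulmx_diag; congr (_ *m (diag_mx _ *m _)).
by apply/rowP => i; rewrite !mxE -rmorphM.
Qed.

Lemma cube_diagonalized :
  (forall i, d 0 i ^+ 3 = d 0 i) -> A *m A *m A = A.
Proof.
move=> d3; apply: (map_mx_inj (f := real_complex R)) => //.
rewrite map_mxM sqr_diagonalized A_diag -!mulmxA (mulmxA P) mulmxV // mul1mx.
rewrite (mulmxA (diag_mx _)) mulmx_diag; congr (_ *m (diag_mx _ *m _)).
by apply/rowP => i; rewrite !mxE -rmorphM -exprSr d3.
Qed.

End SymmetricSpectrum.

(** Both lists contain [x] as often as its multiplicity as a root of [char_poly A]. *)
Lemma perm_eigenvalues (R : rcfType) n (A : 'M[R]_n) (s : seq R) :
  char_poly A = \prod_(x <- s) ('X - x%:P) -> perm_eq (eigenvalues A) s.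
Proof.
move=> A_s; apply/allP => x _ /=; apply/eqP; rewrite /eigenvalues.
have p_neq0 : char_poly A != 0 by rewrite monic_neq0 // char_poly_monic.
rewrite count_flatten -map_comp -(mu_prod_XsubC x s) -A_s.
set p := char_poly A in p_neq0 *.
have -> : sumn [seq (count_mem x \o (fun y => nseq (mup y p) y)) y |
                   y <- rootsR p] =
    (\sum_(y <- rootsR p) if y == x then mup x p else 0)%N.
  rewrite sumnE big_map; apply: eq_bigr => y _ /=; rewrite count_nseq /=.
  by case: eqP => [->|_]; rewrite ?mul1n ?mul0n.
have [x_root|x_nroot] := boolP (root p x); last first.
  by rewrite mupNroot // big1 // => y _; case: ifP.
have x_in : x \in rootsR p by rewrite -roots_on_rootsR // x_root.
rewrite (bigD1_seq x) ?uniq_roots //= eqxx big1 ?addn0 // => y /negPf -> //.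
Qed.

(** For a left eigenvector [v], [a * |v|^2 = |v M|^2]. *)
Lemma eigenvalue_gram_ge0 (R : realFieldType) m n (M : 'M[R]_(m, n)) (a : R) :
  eigenvalue (M *m M^T) a -> 0 <= a.
Proof.
have norm_ge0 k (v : 'rV[R]_k) : 0 <= (v *m v^T) 0 0.
  by rewrite mxE sumr_ge0 // => i _; rewrite mxE -expr2 sqr_ge0.
case/eigenvalueP => v va v_neq0.
have v_gt0 : 0 < (v *m v^T) 0 0.
  rewrite lt_def norm_ge0 andbT; apply: contra v_neq0.
  rewrite mxE psumr_eq0 => [/allP v0|i _]; last by rewrite mxE -expr2 sqr_ge0.
  apply/eqP/rowP => i; apply/eqP; move: (v0 i (mem_index_enum i)).
  by rewrite !mxE -expr2 sqrf_eq0.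
rewrite -(pmulr_lge0 a v_gt0).
suff -> : a * (v *m v^T) 0 0 = ((v *m M) *m (v *m M)^T) 0 0 by [].
by rewrite trmx_mul mulmxA -(mulmxA v) va -scalemxAl [RHS]mxE.
Qed.

(** * Nonnegative matrices and the square root bound *)

(** Nonnegative terms cannot cancel; for powers of [N] this turns a zero entry into the absence of a
    walk. *)
Lemma mulmx_ge0_eq0 (R : numDomainType) m n p
    (A : 'M[R]_(m, n)) (B : 'M[R]_(n, p)) i j k :
    (forall i k, 0 <= A i k) -> (forall k j, 0 <= B k j) ->
  (A *m B) i j = 0 -> A i k * B k j = 0.
Proof.
move=> A0 B0; rewrite mxE => /eqP; rewrite psumr_eq0; last first.
  by move=> l _; rewrite mulr_ge0.
by move=> /allP/(_ k (mem_index_enum k))/eqP.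
Qed.

(** With [s = sqrt (1 + x)], the gap [1 + x / 2 - s] is [(s - 1)^2 / 2]. *)
Lemma sqrt1D_leif (R : rcfType) (x : R) : -1 <= x ->
  Num.sqrt (1 + x) <= 1 + x / 2 ?= iff (x == 0).
Proof.
move=> x_ge; set s := Num.sqrt (1 + x).
have s2 : s ^+ 2 = 1 + x by rewrite sqr_sqrtr // -lerBlDl sub0r.
have -> : x = s ^+ 2 - 1 by rewrite s2; ring.
split; first by have := sqr_ge0 (s - 1); lra.
apply/eqP/eqP => [s_eq|].
  have /eqP : (s - 1) ^+ 2 = 0 by lra.
  by rewrite sqrf_eq0 subr_eq0 => /eqP ->; ring.
have s_ge0 : 0 <= s by apply: sqrtr_ge0.
by move/eqP; rewrite subr_eq0 sqrf_eq1 => /orP[] /eqP s_eq;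
  rewrite s_eq in s_ge0 *; lra.
Qed.

Lemma sum_sqrt1D_leif (R : rcfType) (s : seq R) :
    {in s, forall x, -1 <= x} -> \sum_(x <- s) x = 0 ->
  \sum_(x <- s) Num.sqrt (1 + x) <= (size s)%:R ?= iff all (pred1 0) s.
Proof.
move=> s_ge s_sum.
have -> : (size s)%:R = \sum_(x <- s) (1 + x / 2).
  by rewrite big_split /= -mulr_suml s_sum mul0r addr0 big_const_seq
     count_predT iter_addr_0.
(* The zero sum is dropped because it does not pass to tails; the bound by the sum of the
   [1 + x / 2] does. *)
elim: s s_ge {s_sum} => [|x s IHs] s_ge; first by
  rewrite !big_nil; exact/leif_refl.
rewrite !big_cons /=; apply: leifD; first exact/sqrt1D_leif/s_ge/mem_head.
by apply: IHs => y ys; apply: s_ge; rewrite inE ys orbT.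
Qed.

(** * Paths, 2-colourings and star centres in trees *)

Section Trees.
Variable G : sgraph.

(** Where two simple paths with the same ends first part, going along one and back along the other
    closes a cycle. *)
Lemma acyclic_uniq_path (x : G) (p q : seq G) : acyclic G ->
    path (@adj G) x p -> uniq (x :: p) ->
    path (@adj G) x q -> uniq (x :: q) -> last x p = last x q ->
  p = q.
Proof.
move=> acG; elim: p x q => [|a p IHp] x [|b q] //=.
- by move=> _ _ _ /andP[/negP xNq _] x_last; case: xNq; rewrite {1}x_last mem_last.
- by move=> _ /andP[/negP xNp _] _ _ x_last; case: xNp; rewrite -{1}x_last mem_last.
case/andP=> xa ap /andP[xNp up] /andP[xb bq] /andP[xNq uq] lastE.
have [ab|abN] := eqVneq a b.
  by subst b; congr cons; apply: IHp lastE.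
(* Otherwise [r] leads from [a] back to [b] without meeting [x]. *)
exfalso; pose r := p ++ rev (belast b q).
have r_path : path (@adj G) a r.
  rewrite cat_path ap lastE /=.
  rewrite (eq_path (e' := fun u v => adj v u)) ?rev_path // => u v.
  by rewrite adj_sym.
have r_last : last a r = b.
  rewrite last_cat lastE; case: q {bq uq lastE r r_path xNq} => //= c q.
  by rewrite rev_cons last_rcons.
have r_sub : {subset a :: r <= (a :: p) ++ (b :: q)}.
  move=> z; rewrite -cat_cons !mem_cat mem_rev => /orP[-> //|/mem_belast ->].
  by rewrite orbT.
case: (shortenP r_path) r_last => r' r'_path r'_uniq r'_sub r'_last.
have xNr : x \notin a :: r'.
  apply/negP => xr; have : x \in (a :: p) ++ (b :: q).
    apply: r_sub; move: xr; rewrite !inE => /orP[-> //|/r'_sub ->].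
    by rewrite orbT.
  by rewrite mem_cat (negPf xNp) (negPf xNq).
apply: (acG (x :: a :: r')).
  (* [r'] is nonempty because [a != b], so the cycle has at least 3 vertices. *)
  by case: r' r'_last {r'_path r'_uniq r'_sub xNr} => //= /eqP; rewrite (negPf abN).
apply/andP; split; last by rewrite cons_uniq xNr.
by rewrite /cycle rcons_path [path _ _ _]/= xa r'_path /= r'_last adj_sym xb.
Qed.

Lemma tree_bipartite : tree G ->
  exists f : G -> bool, forall u v, adj u v -> f v = ~~ f u.
Proof.
case=> -[/card_gt0P[r _] conG] acG.
have /fin_all_exists[P Pr] (u : G) : exists p,
    [/\ path (@adj G) r p, uniq (r :: p) & u = last r p].
  have /connectP[p rp ->] := conG r u.
  by case: (shortenP rp) => q rq uq _; exists q.
(* The colour of [u] is the parity of its distance to the root [r]. *)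
exists (fun u => odd (size (P u))) => u v uv.
have [ru uu u_last] := Pr u; have [rv rvu v_last] := Pr v.
(* Either [v] lies on the path to [u], and uniqueness makes it the last vertex before [u], or it
   extends that path; both flip the parity. *)
have [v_in|v_out] := boolP (v \in r :: P u).
  have [p1 [p2 [P_cat v_p1]]] : exists p1 p2, P u = p1 ++ p2 /\ v = last r p1.
    by case/splitPl: v_in => p1 p2 <-; exists p1, p2.
  move: (ru); rewrite P_cat cat_path -v_p1 => /andP[rp1 vp2].
  move: (uu); rewrite P_cat -cat_cons cat_uniq => /and3P[up1 /hasPn p12 up2].
  have P_v : P v = p1 by apply: (acyclic_uniq_path acG rv) => //; rewrite -v_last.
  have p2_u : p2 = [:: u].
    apply: (acyclic_uniq_path (x := v)) => //=.
    - rewrite up2 andbT; apply/negP => /p12; rewrite v_p1; apply/negP.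
      by rewrite negbK mem_last.
    - by rewrite adj_sym uv.
    - rewrite inE andbT; apply/eqP => vu.
      by move: uv; rewrite vu adj_irrefl.
    - by move: u_last; rewrite P_cat last_cat -v_p1 => /esym.
  by rewrite P_v p2_u size_cat addn1 /= negbK.
have -> : P v = rcons (P u) v.
  apply: (acyclic_uniq_path acG rv) => //.
  - by rewrite rcons_path ru -u_last.
  - by rewrite -rcons_cons rcons_uniq v_out.
  - by rewrite last_rcons -v_last.
by rewrite size_rcons.
Qed.

Lemma connected_degree_gt0 (u : G) : connected G -> (1 < #|G|)%N ->
  (0 < degree u)%N.
Proof.
move=> [_ conG] G_gt1; have [v vNu] : exists v, v != u.
  apply/existsP; apply: contraTT G_gt1 => /existsPn uG.
  rewrite -leqNgt (cardD1 u) inE addnC addn1 ltnS leqn0; apply/eqP/eq_card0 => v.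
  by rewrite !inE; have := uG v; rewrite negbK => /eqP->; rewrite eqxx.
have /connectP[[|w p] /= uw v_last] := conG u v.
  by rewrite v_last eqxx in vNu.
by apply/card_gt0P; exists w; rewrite inE; case/andP: uw.
Qed.

(** The exclusive or also excludes a loop at [c], and it describes a star without naming its
    leaves. *)
Definition star_center (c : G) := forall u v, adj u v = (u == c) (+) (v == c).

(** Walks alternate between [c] and other vertices, so a triangle is impossible and a longer cycle
    would visit [c] twice. *)
Lemma star_center_acyclic (c : G) : star_center c -> acyclic G.
Proof.
move=> cG [|x [|y [|z s]]] //= _ /andP[/=].
rewrite !cG => /and3P[xy yz]; move: xy yz.
have [->|yNc] := eqVneq y c.
  rewrite !addbT => xNc zNc; case: s => [|w s] /=.
    by rewrite cG (negPf xNc) (negPf zNc).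
  rewrite cG (negPf zNc) /= => /andP[/eqP -> _].
  by rewrite !inE eqxx /= !orbT andbF.
rewrite addbF /= => /eqP -> /eqP -> _.
by rewrite !inE eqxx !orbT.
Qed.

Lemma star_center_connected (c : G) : star_center c -> connected G.
Proof.
move=> cG; split; first by apply/card_gt0P; exists c.
have con_c u : connect (@adj G) u c.
  have [-> // |uNc] := eqVneq u c.
  by apply: connect1; rewrite cG eqxx (negPf uNc).
have symG : connect_sym (@adj G) by apply/sym_connect_sym/adj_sym.
by move=> u v; apply: connect_trans (con_c u) _; rewrite symG.
Qed.

(** The edge joining the ends of a walk with 3 edges would close a 4-cycle unless the walk
    backtracks. The centre is then found as the neighbour of a leaf. *)
Lemma no_path3_star_center : tree G -> (1 < #|G|)%N ->
    (forall u a b v : G, adj u a -> adj a b -> adj b v -> adj u v) ->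
  exists c, star_center c.
Proof.
move=> [conG acG] G_gt1 no3.
have adjN (u v : G) : adj u v -> u != v.
  by apply: contraTneq => ->; rewrite adj_irrefl.
have path3 (u a b v : G) : adj u a -> adj a b -> adj b v -> u = b \/ v = a.
  move=> ua ab bv; have uv := no3 _ _ _ _ ua ab bv.
  have [|ubN] := eqVneq u b; first by left.
  have [|vaN] := eqVneq v a; first by right.
  case: (acG [:: u; a; b; v]) => //.
  rewrite /ucycle /= ua ab bv adj_sym uv !inE !negb_or ubN (eq_sym a v).
  by rewrite vaN (adjN _ _ ua) (adjN _ _ uv) (adjN _ _ ab) (adjN _ _ bv).
(* Take an edge [u w]. If [w] has another neighbour, then by [path3] [u] is a leaf attached to [w];
   otherwise [w] is a leaf attached to [u]. *)
have [c [l cl lc]] :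
    exists c : G, exists2 l : G, adj c l & forall v : G, adj v l -> v = c.
  have [u _] := card_gt0P conG.1.
  have /card_gt0P[w] := connected_degree_gt0 u conG G_gt1; rewrite inE => uw.
  have [/existsP[v /andP[vw vNu]]|/existsPn wu] :=
    boolP [exists v, adj v w && (v != u)]; last first.
    exists u, w => // v vw; apply/eqP; have := wu v.
    by rewrite vw /= negbK.
  exists w, u; first by rewrite adj_sym.
  move=> x xu; case: (path3 x u w v) => //; first by rewrite adj_sym.
  by move=> vu; rewrite vu eqxx in vNu.
(* Starting [path3] at the leaf [l] shows that a neighbour of [c] has no neighbour but [c]. *)
have nbr_c x y : adj c x -> adj x y -> y = c.
  move=> cx xy; have [xl|xNl] := eqVneq x l.
    by apply: lc; rewrite adj_sym -xl.
  case: (path3 l c x y) => //; first by rewrite adj_sym.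
  by move=> lx; rewrite lx eqxx in xNl.
(* Hence a path from [c] never gets farther than one step away. *)
have c_adj x : x != c -> adj c x.
  have /connectP[p cp ->] := conG.2 c x.
  elim/last_ind: p cp => [|p y IHp] /=; first by rewrite eqxx.
  rewrite rcons_path last_rcons => /andP[/IHp{}IHp py yNc].
  have [pc|/IHp cp] := eqVneq (last c p) c; first by rewrite -{1}pc.
  by rewrite (nbr_c _ _ cp py) eqxx in yNc.
exists c => u v; have [->|uNc] := eqVneq u c.
  have [->|/c_adj //] := eqVneq v c; exact: adj_irrefl.
have [->|vNc] := eqVneq v c; first by rewrite adj_sym c_adj.
by apply/negP => uv; move: vNc; rewrite (nbr_c _ _ (c_adj _ uNc) uv) eqxx.
Qed.

End Trees.

(** * Stars up to isomorphism *)

(** The centre determines adjacency, so a bijection only has to match centres; a transposition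
    corrects an arbitrary one. *)
Lemma star_center_isomorphic (G H : sgraph) (c : G) (c' : H) :
  star_center c -> star_center c' -> #|G| = #|H| -> isomorphic G H.
Proof.
move=> cG c'H GH.
pose h (x : G) : H := enum_val (cast_ord GH (enum_rank x)).
have h_inj : injective h.
  by move=> x y /enum_val_inj/cast_ord_inj/enum_rank_inj.
pose f x := tperm (h c) c' (h x).
have f_inj : injective f by move=> x y /perm_inj/h_inj.
have fc x : (f x == c') = (x == c).
  by rewrite -(inj_eq f_inj); congr (_ == _); rewrite /f tpermL.
exists f; first by apply: inj_card_bij; rewrite // GH.
by move=> u v; rewrite c'H cG !fc.
Qed.

Lemma star_center_inl n : star_center (inl ord0 : star n).
Proof. by case=> [i|i] [j|j]; rewrite //= ?(ord1 i) ?(ord1 j). Qed.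

Lemma card_star n : (0 < n)%N -> #|star n| = n.
Proof. by move=> n_gt0; rewrite card_sum !card_ord add1n prednK. Qed.

(** * The Gram matrix of the incidence matrix and the normalized adjacency matrix *)

(** These counts are the entries of [D + A]: edges at [u] correspond to its neighbours, and two
    distinct vertices share at most the edge [[set u; v]]. *)
Lemma card_edges_at (G : sgraph) (u v : G) :
  #|[set E in edges G | (u \in E) && (v \in E)]| =
    (if u == v then degree u else adj u v)%N.
Proof.
have edgeP E :
    reflect (exists u v : G, adj u v /\ E = [set u; v]) (E \in edges G).
  rewrite inE.
  apply: (iffP existsP) => [[x /existsP[y /andP[xy /eqP]]]|[x [y [xy ->]]]].
    by exists x, y.
  by exists x; apply/existsP; exists y; rewrite xy eqxx.
have adjN (x y : G) : adj x y -> x != y.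
  by apply: contraTneq => ->; rewrite adj_irrefl.
have [<-|uNv] := eqVneq u v.
  rewrite /degree -(card_in_imset (f := fun w => [set u; w])) => [|x y]; last first.
    rewrite !inE => ux uy /setP/(_ x).
    rewrite !inE eqxx orbT => /esym/orP[/eqP xu|/eqP //].
    by have := adjN _ _ ux; rewrite xu eqxx.
  congr #|pred_of_set _|; apply/setP => E; rewrite in_set andbb.
  apply/andP/imsetP => [[/edgeP[x [y [xy ->]]]]|[w]].
    rewrite !inE => /orP[] /eqP uE; subst u; first by exists y; rewrite ?inE.
    by exists x; rewrite ?inE 1?adj_sym // setUC.
  rewrite inE => uw ->; split; last by rewrite !inE eqxx.
  by apply/edgeP; exists u, w.
have [uv|uvN] := boolP (adj u v).
  apply: etrans (cards1 [set u; v]); congr #|pred_of_set _|; apply/setP => E.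
  rewrite in_set1 inE; apply/andP/eqP => [[/edgeP[x [y [xy ->]]]]|->].
    rewrite !inE => /andP[/orP[]/eqP uE /orP[]/eqP vE]; subst u v;
      rewrite ?eqxx // in uNv *.
    by rewrite setUC.
  split; last by rewrite !inE !eqxx orbT.
  by apply/edgeP; exists u, v.
apply: eq_card0 => E; rewrite inE; apply/negP => /andP[/edgeP[x [y [xy ->]]]].
rewrite !inE => /andP[/orP[]/eqP uE /orP[]/eqP vE]; subst u v;
  by rewrite ?eqxx ?xy // adj_sym xy in uNv uvN.
Qed.

Lemma sum_enum_val (R : nmodType) (T : finType) (F : T -> R) :
  \sum_(i < #|T|) F (enum_val i) = \sum_x F x.
Proof. by rewrite -big_enum_val; apply: eq_bigl. Qed.

Definition normalized_adjacency (R : rcfType) (G : sgraph) : 'M[R]_#|G| :=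
  \matrix_(i, j) ((adj (enum_val i) (enum_val j))%:R /
    (Num.sqrt (degree (enum_val i))%:R * Num.sqrt (degree (enum_val j))%:R)).

Section NormalizedAdjacency.
Variables (R : rcfType) (G : sgraph).
Hypothesis deg_gt0 : forall u : G, (0 < degree u)%N.
Local Notation N := (normalized_adjacency R G).

Let sqrt_deg (u : G) : R := Num.sqrt (degree u)%:R.

Let sqrt_deg_gt0 u : 0 < sqrt_deg u.
Proof. by rewrite sqrtr_gt0 ltr0n. Qed.

Let sqrt_deg_neq0 u : sqrt_deg u != 0.
Proof. exact: lt0r_neq0. Qed.

Let sqr_sqrt_deg u : sqrt_deg u * sqrt_deg u = (degree u)%:R.
Proof. by rewrite -expr2 sqr_sqrtr. Qed.

Lemma normalized_adjacency_sym : N^T = N.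
Proof. by apply/matrixP => i j; rewrite !mxE adj_sym [X in _ / X]mulrC. Qed.

(** Each edge containing [u] and [v] adds the same product, so the entry is that product times the
    count of [card_edges_at]; on the diagonal the degree cancels to 1. *)
Lemma randic_gram :
  randic_incidence R G *m (randic_incidence R G)^T = 1%:M + N.
Proof.
apply/matrixP => i j; rewrite !mxE.
set u := enum_val i; set v := enum_val j.
transitivity (\sum_(E in edges G | (u \in E) && (v \in E))
    ((sqrt_deg u)^-1 * (sqrt_deg v)^-1)).
  rewrite [RHS]big_mkcondr [RHS]big_enum_val; apply: eq_bigr => k _.
  rewrite !mxE -/u -/v.
  by do 2!case: (_ \in enum_val k); rewrite ?mulr0 ?mul0r.
rewrite sumr_const -[LHS]mulr_natl.
have -> : #|[pred E | E \in edges G & (u \in E) && (v \in E)]| =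
    (if u == v then degree u else adj u v)%N.
  by rewrite -card_edges_at; apply: eq_card => E; rewrite in_set.
rewrite (inj_eq enum_val_inj) -invfM -/(sqrt_deg u) -/(sqrt_deg v).
have [ij|_] := eqVneq i j; last by rewrite add0r.
rewrite /u /v -ij adj_irrefl mul0r addr0 sqr_sqrt_deg mulfV //.
by rewrite pnatr_eq0 -lt0n.
Qed.

(** The weights [e u * sqrt_deg u] form a left eigenvector. Constant [e] will give [t = 1], and the
    signs of a 2-colouring [t = -1]. *)
Lemma normalized_adjacency_eigen (t : R) (e : G -> R) :
    (exists u, e u != 0) -> (forall u v, adj u v -> e u = t * e v) ->
  root (char_poly N) t.
Proof.
move=> [u0 eu0] e_adj; rewrite -eigenvalue_root_char; apply/eigenvalueP.
exists (\row_i (e (enum_val i) * sqrt_deg (enum_val i))).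
  apply/rowP => j; rewrite !mxE; set v := enum_val j.
  pose F u := e u * sqrt_deg u * ((adj u v)%:R / (sqrt_deg u * sqrt_deg v)).
  transitivity (\sum_u F u).
    by rewrite -[RHS]sum_enum_val; apply: eq_bigr => i _; rewrite !mxE.
  (* The factors [sqrt_deg u] cancel, so the [degree v] neighbours contribute equally. *)
  transitivity (\sum_(u | adj v u) (t * e v / sqrt_deg v)).
    rewrite [RHS]big_mkcond; apply: eq_bigr => u _; rewrite /F adj_sym.
    case: ifP => [vu|_]; last by rewrite mul0r mulr0.
    by rewrite -(e_adj u) 1?adj_sym // mul1r; field; rewrite !sqrt_deg_neq0.
  rewrite sumr_const -[LHS]mulr_natl.
  have -> : #|[pred u | adj v u]| = degree v by apply: eq_card => u; rewrite !inE.
  by rewrite -sqr_sqrt_deg; field.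
apply/eqP => /rowP/(_ (enum_rank u0)); rewrite !mxE enum_rankK => /eqP.
by rewrite mulf_eq0 (negPf eu0) (negPf (sqrt_deg_neq0 _)).
Qed.

Lemma normalized_adjacency_entry u v :
  N (enum_rank u) (enum_rank v) = (adj u v)%:R / (sqrt_deg u * sqrt_deg v).
Proof. by rewrite mxE !enum_rankK. Qed.

Lemma normalized_adjacency_ge0 i j : 0 <= N i j.
Proof. by rewrite mxE divr_ge0 // mulr_ge0 // sqrtr_ge0. Qed.

(** Otherwise the [(u, v)] entry of [N] is 0, whereas the walk [u a b v] contributes a positive term
    to that of the cube. *)
Lemma normalized_adjacency_cube (u a b v : G) : N *m N *m N = N ->
  adj u a -> adj a b -> adj b v -> adj u v.
Proof.
move=> N3 ua ab bv; apply/negPn/negP => uvN.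
have N_neq0 x y : adj x y -> N (enum_rank x) (enum_rank y) != 0.
  move=> xy; rewrite normalized_adjacency_entry xy mul1r invr_eq0 mulf_neq0 //.
have N2_ge0 i j : 0 <= (N *m N) i j.
  by rewrite mxE sumr_ge0 // => k _; rewrite mulr_ge0 ?normalized_adjacency_ge0.
have /(congr1 (fun A : 'M_ _ => A (enum_rank u) (enum_rank v))) := N3.
rewrite normalized_adjacency_entry (negPf uvN) mul0r.
move/(mulmx_ge0_eq0 (enum_rank b) N2_ge0 normalized_adjacency_ge0)/eqP.
rewrite mulf_eq0 (negPf (N_neq0 _ _ bv)) orbF => /eqP.
have N_ge0 := normalized_adjacency_ge0.
move/(mulmx_ge0_eq0 (enum_rank a) N_ge0 N_ge0)/eqP.
by rewrite mulf_eq0 !(negPf (N_neq0 _ _ _)).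
Qed.

Lemma mxtrace_normalized_adjacency : \tr N = 0.
Proof. by rewrite /mxtrace big1 // => i _; rewrite mxE adj_irrefl mul0r. Qed.

Lemma mxtrace_sqr_normalized_adjacency :
  \tr (N *m N) = \sum_(u : G) \sum_(v : G)
    (adj u v)%:R / ((degree u)%:R * (degree v)%:R).
Proof.
rewrite /mxtrace -[RHS]sum_enum_val; apply: eq_bigr => i _.
rewrite mxE -[RHS]sum_enum_val.
apply: eq_bigr => j _; rewrite !mxE [adj (enum_val j) _]adj_sym.
case: adj; last by rewrite !mul0r.
rewrite !mul1r -/(sqrt_deg (enum_val i)) -/(sqrt_deg (enum_val j)) -!sqr_sqrt_deg.
field.
by rewrite !sqrt_deg_neq0.
Qed.

End NormalizedAdjacency.

(** * Energy of trees and of the star *)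

Lemma tree_energy (R : rcfType) (T : sgraph) (N := normalized_adjacency R T)
    (m := Num.sqrt 2 + (#|T| - 2)%:R) :
    tree T -> (1 < #|T|)%N ->
  [/\ randic_incidence_energy R T <= m,
      randic_incidence_energy R T = m -> N *m N *m N = N &
      \tr (N *m N) = 2 -> randic_incidence_energy R T = m].
Proof.
move=> treeT T_gt1; have [conT _] := treeT.
have deg_gt0 u := connected_degree_gt0 u conT T_gt1.
have [d [P P_unit N_diag]] :=
  symmetric_diagonalization (normalized_adjacency_sym R T).
pose s := [seq d 0 i | i <- index_enum 'I_#|T|].
have s_sum F : \sum_(x <- s) F x = \sum_i F (d 0 i) :> R by rewrite big_map.
have root_s x : root (char_poly N) x -> x \in s.
  rewrite (char_poly_diagonalized P_unit N_diag).
  by rewrite -(big_map (fun i => d 0 i) xpredT (fun x => 'X - x%:P)) root_prod_XsubC.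
have s1 : 1 \in s.
  have /card_gt0P[r _] := conT.1.
  apply/root_s/(normalized_adjacency_eigen deg_gt0 (e := fun=> 1)) => [|u v _].
    by exists r; apply: oner_neq0.
  by rewrite mulr1.
have sN1 : -1 \in s.
  have [f f_adj] := tree_bipartite treeT; have /card_gt0P[r _] := conT.1.
  apply/root_s/(normalized_adjacency_eigen deg_gt0 (e := fun u => (-1) ^+ f u)).
    by exists r; rewrite signr_eq0.
  by move=> u v /f_adj ->; rewrite signrN mulN1r opprK.
(* [s'] lists the remaining eigenvalues; as -1 and 1 differ, removing 1 leaves an occurrence of
   -1. *)
have [s' s_perm] : exists s', perm_eq s (1 :: -1 :: s').
  exists (rem (-1) (rem 1 s)); rewrite (permPl (perm_to_rem s1)) perm_cons.
  rewrite perm_to_rem //; move: sN1; rewrite (perm_mem (perm_to_rem s1)) inE.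
  by rewrite (@lt_eqF _ _ (-1)) //; lra.
have s'_sum F : \sum_i F (d 0 i) = F 1 + (F (-1) + \sum_(x <- s') F x) :> R.
  by rewrite -s_sum (perm_big _ s_perm) !big_cons.
have char_s :
    char_poly (1%:M + N) = \prod_(x <- [seq 1 + x | x <- s]) ('X - x%:P).
  by rewrite 2!big_map (char_poly_add1_diagonalized P_unit N_diag).
have energyE : randic_incidence_energy R T =
    Num.sqrt 2 + \sum_(x <- s') Num.sqrt (1 + x).
  rewrite /randic_incidence_energy /singular_values big_map randic_gram //.
  rewrite (perm_big _ (perm_eigenvalues char_s)).
  rewrite big_map s_sum (s'_sum (fun x => Num.sqrt (1 + x))).
  by rewrite subrr sqrtr0 add0r.
(* The numbers [1 + x] are eigenvalues of the Gram matrix [1 + N], hence nonnegative. *)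
have s_ge x : x \in s -> -1 <= x.
  move=> xs; rewrite -subr_ge0 opprK addrC.
  apply: (@eigenvalue_gram_ge0 _ _ _ (randic_incidence R T)).
  rewrite eigenvalue_root_char randic_gram // char_s.
  by rewrite root_prod_XsubC map_f.
have s'_ge : {in s', forall x, -1 <= x}.
  by move=> x xs'; apply: s_ge; rewrite (perm_mem s_perm) !inE xs' !orbT.
(* The trace of [N] is 0, and the eigenvalues 1 and -1 cancel in it. *)
have s'_sum0 : \sum_(x <- s') x = 0.
  have := mxtrace_diagonalized P_unit N_diag.
  by rewrite mxtrace_normalized_adjacency (s'_sum id) addNKr => <-.
have size_s' : size s' = (#|T| - 2)%N.
  have := perm_size s_perm; rewrite size_map /= => sz.
  have : size (index_enum 'I_#|T|) = #|T| by rewrite -sum1_size sum1_card card_ord.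
  by rewrite sz => <-; rewrite subn2.
have [] := sum_sqrt1D_leif s'_ge s'_sum0; rewrite size_s' => le_sum eq_sum.
rewrite energyE /m; split; first by rewrite lerD2l.
(* All eigenvalues are now 1, -1 or 0, the fixed points of cubing. *)
- move/addrI/eqP; rewrite eq_sum => /allP s'0.
  apply: (cube_diagonalized P_unit N_diag) => i.
  have : d 0 i \in s by rewrite map_f // mem_index_enum.
  rewrite (perm_mem s_perm) !inE => /or3P[/eqP->|/eqP->|/s'0/eqP->].
  + by rewrite expr1n.
  + by rewrite -signr_odd.
  + by rewrite expr0n.
(* The eigenvalues 1 and -1 already account for the trace 2 of [N^2], so the squares of the others
   add up to 0. *)
- have := sqr_diagonalized P_unit N_diag => N2_diag.
  rewrite (mxtrace_diagonalized P_unit N2_diag).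
  under eq_bigr do rewrite mxE; rewrite (s'_sum (fun x => x ^+ 2)).
  rewrite sqrrN !expr1n => s_eq; have /eqP : \sum_(x <- s') x ^+ 2 = 0 by lra.
  rewrite psumr_eq0 => [/allP s'0|x _]; last exact: sqr_ge0.
  congr (_ + _); apply/eqP; rewrite eq_sum; apply/allP => x /s'0.
  by rewrite /= sqrf_eq0.
Qed.

(** Each of the n - 1 edges joins degrees n - 1 and 1, so it adds [1 / (n - 1)] twice to the trace
    of [N^2], which is therefore 2; the third clause of [tree_energy] applies. *)
Lemma star_energy (R : rcfType) n : (1 < n)%N ->
  randic_incidence_energy R (star n) = Num.sqrt 2 + (n - 2)%:R.
Proof.
move=> n_gt1; have n_gt0 := ltnW n_gt1; have cN := @star_center_inl n.
have n1_neq0 : n.-1%:R != 0 :> R by rewrite pnatr_eq0 -lt0n -subn1 subn_gt0.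
have tree_star : tree (star n).
  by split; [apply: star_center_connected cN | apply: star_center_acyclic cN].
have [|_ _ ->] := @tree_energy R (star n) tree_star; rewrite ?card_star //.
rewrite mxtrace_sqr_normalized_adjacency; last first.
  by move=> u; apply: connected_degree_gt0 tree_star.1 _; rewrite card_star.
have deg_l i : degree (inl i : star n) = n.-1.
  rewrite /degree -[RHS](card_ord n.-1) -(card_imset predT (@inr_inj 'I_1 'I_n.-1)).
  apply: eq_card => -[j|j]; rewrite inE /=.
    by apply/esym/imsetP => -[].
  by rewrite mem_imset //; apply: inr_inj.
have deg_r i : degree (inr i : star n) = 1%N.
  rewrite /degree -[RHS](card_ord 1) -(card_imset predT (@inl_inj 'I_1 'I_n.-1)).
  apply: eq_card => -[j|j]; rewrite inE /=.
    by rewrite mem_imset //; apply: inl_inj.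
  by apply/esym/imsetP => -[].
rewrite big_sumType /= big_ord1 [X in X + _]big_sumType /= big_ord1 mul0r add0r.
under eq_bigr do rewrite deg_l deg_r mulr1 mul1r.
under [X in _ + X]eq_bigr => i _.
  rewrite big_sumType /= big_ord1 deg_l deg_r mul1r mul1r.
  rewrite big1 ?addr0 => [|j _]; last by rewrite mul0r.
  over.
by rewrite !sumr_const card_ord ?mulr1 -[_^-1 *+ _]mulr_natl mulfV.
Qed.

(** The one-vertex case lies outside [tree_energy], whose argument rests on positive degrees. *)
Lemma order1_energy (R : rcfType) (G : sgraph) : #|G| = 1%N ->
  randic_incidence_energy R G = 0.
Proof.
move=> G1; have I0 : randic_incidence R G = 0.
  apply/matrixP => i j; rewrite !mxE; case: ifP => // _.
  (* An entry [(sqrt 0)^-1] is 0 by the convention [0^-1 = 0]. *)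
  have -> : degree (enum_val i) = 0%N; last by rewrite sqrtr0 invr0.
  apply: eq_card0 => u; rewrite !inE.
  by rewrite (fintype_le1P _ u (enum_val i)) ?adj_irrefl ?G1.
rewrite /randic_incidence_energy /singular_values I0 mul0mx big_map.
rewrite (perm_big _ (perm_eigenvalues (s := nseq #|G| 0) _)) /=.
  by rewrite big_nseq sqrtr0 iter_addr_0 mul0rn.
rewrite char_poly_trig; last by apply/is_trig_mxP => i j _; rewrite mxE.
rewrite big_nseq -big_const_ord.
by apply: eq_bigr => i _; rewrite mxE.
Qed.

Theorem theorem4p2 (R : rcfType) (n : nat) (n_gt0 : (0 < n)%N) :
  [/\ tree (star n),
      #|star n| = n &
      forall T : sgraph, tree T -> #|T| = n ->
        randic_incidence_energy R T <= randic_incidence_energy R (star n) /\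
        (randic_incidence_energy R T = randic_incidence_energy R (star n) ->
         isomorphic T (star n))].
Proof.
have cS := @star_center_inl n; split; last first.
- move=> T treeT Tn; have [n_gt1|n_le1] := ltnP 1 n.
    have T_gt1 : (1 < #|T|)%N by rewrite Tn.
    have [le_m eq_m _] := tree_energy R treeT T_gt1.
    rewrite star_energy // -[in (n - 2)%N]Tn; split=> // /eq_m N3.
    have deg_gt0 u := connected_degree_gt0 u treeT.1 T_gt1.
    have [] := no_path3_star_center treeT T_gt1.
      by move=> u a b v; apply: normalized_adjacency_cube N3.
    by move=> c cT; apply: star_center_isomorphic cT cS _; rewrite card_star.
  (* For n = 1 both energies are 0, and the single vertex serves as the centre. *)
  have n1 : n = 1%N by apply/eqP; rewrite eqn_leq n_le1.
  rewrite !order1_energy ?card_star ?Tn //; split=> // _.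
  have [c _] := card_gt0P treeT.1.1.
  have cT : star_center c.
    move=> u v; have T1 x : x = c by apply: fintype_le1P; rewrite Tn.
    by rewrite (T1 u) (T1 v) eqxx adj_irrefl.
  by apply: star_center_isomorphic cT cS _; rewrite card_star.
- exact: card_star.
- by split; [apply: star_center_connected cS | apply: star_center_acyclic cS].
Qed.
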